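(* Let $F$ be a nonarchimedean field with multiplicative norm $|\cdot|_F$, and suppose that the norm group $|F^\times| = \{|x|_F : x \in F^\times\}$ is dense in $\mathbb{R}^+ = (0,\infty)$. Let $A$ be a uniform Banach algebra over $F$. If $A$ is a Banach field, then $A$ is a nonarchimedean field.
   Context: All rings are commutative with unit. A submultiplicative (nonarchimedean) norm on a ring $R$ is a function $|\cdot|: R \to [0,\infty)$ with $|x| = 0$ if and only if $x=0$, $|x-y| \leq \max\{|x|,|y|\}$ and $|xy| \leq |x||y|$ for all $x,y \in R$; it is a multiplicative norm if moreover $|xy| = |x||y|$ always and $|1| \neq 0$. A Banach ring is a complete topological commutative ring whose topology is induced by some submultiplicative norm. It is discrete if it carries the discrete topology and nondiscrete otherwise. A Banach field is a Banach ring whose underlying ring is a field. A nonarchimedean field is a nondiscrete Banach field whose topology is induced by some multiplicative nonarchimedean norm. A Banach algebra over a nonarchimedean field $F$ is a Banach ring $A$ equipped with a continuous ring homomorphism $F \to A$. For a Banach ring $A$, a subset $S \subseteq A$ is bounded if for every neighborhood $U$ of $0$ there is a neighborhood $V$ of $0$ with $vs \in U$ for all $v \in V$, $s \in S$. An element $x \in A$ is power-bounded if $\{x^n : n \geq 0\}$ is bounded; $A^\circ$ denotes the subring of power-bounded elements. $A$ is uniform if $A^\circ$ is bounded in $A$. *)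

(* Defs.v *)
From HB Require Import structures.
From mathcomp Require Import all_boot all_order all_algebra.
From mathcomp Require Import all_classical all_reals all_analysis.

Set Implicit Arguments.
Unset Strict Implicit.
Unset Printing Implicit Defensive.

Import Order.TTheory GRing.Theory Num.Theory.
Import numFieldNormedType.Exports.

Local Open Scope classical_set_scope.
Local Open Scope ring_scope.

Section Norms.
Context (R : realType) (A : comPzRingType).

Record submultiplicative_norm (N : A -> R) : Prop := SubmultiplicativeNorm {
  nonarch_norm_ge0 : forall x, 0 <= N x ;
  nonarch_norm_eq0 : forall x, N x = 0 <-> x = 0 ;
  nonarch_norm_ultra : forall x y, N (x - y) <= Num.max (N x) (N y) ;
  nonarch_norm_submul : forall x y, N (x * y) <= N x * N y
}.

Record multiplicative_norm (N : A -> R) : Prop := MultiplicativeNorm {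
  multiplicative_norm_submul : submultiplicative_norm N ;
  multiplicative_normM : forall x y, N (x * y) = N x * N y ;
  multiplicative_norm1_neq0 : N 1 <> 0
}.

End Norms.

HB.mixin Record TopologicalZmodule_isTopologicalComRing A
    & TopologicalZmodule A & GRing.ComPzRing A := {
  ring_mul_continuous : continuous (fun x : A * A => x.1 * x.2)
}.

#[short(type="topologicalComRingType")]
HB.structure Definition TopologicalComRing :=
  {A of TopologicalZmodule A & GRing.ComPzRing A
        & TopologicalZmodule_isTopologicalComRing A}.

Definition induces_topology (R : realType) (A : topologicalComRingType)
  (N : A -> R) : Prop := forall x : A, nbhs x = nbhs_ball_ (ball_ N) x.

(* A Cauchy filter for the canonical uniform structure of the topological group
   (A, +).  The library's [cauchy] and completeType would need a uniform
   structure (and a point) as additional data on A. *)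
Definition additive_cauchy (A : topologicalComRingType) (G : set_system A)
  : Prop := (fun xy : A * A => xy.1 - xy.2) @ (G, G) --> (0 : A).

HB.mixin Record TopologicalComRing_isBanachRing (R : realType) A
    & TopologicalComRing A := {
  banach_complete :
    forall G : set_system A, ProperFilter G -> additive_cauchy G ->
      exists l : A, G --> l ;
  banach_norm_exists :
    exists N : A -> R, submultiplicative_norm N /\ induces_topology N
}.

#[short(type="banachRingType")]
HB.structure Definition BanachRing (R : realType) :=
  {A of TopologicalComRing A & TopologicalComRing_isBanachRing R A}.

#[short(type="banachFieldType")]
HB.structure Definition BanachField (R : realType) :=
  {A of BanachRing R A & GRing.Field A}.

Definition nonarchimedean_field (R : realType) (K : banachFieldType R) : Prop :=
  ~ (forall S : set K, open S) /\
  exists N : K -> R, multiplicative_norm N /\ induces_topology N.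

Definition norm_group (R : realType) (K : banachFieldType R) (N : K -> R)
  : set R := N @` [set x | x != 0].

Section Boundedness.
Context (A : topologicalComRingType).

Definition ring_bounded (S : set A) : Prop :=
  forall U : set A, nbhs 0 U ->
    exists2 V : set A, nbhs 0 V & forall v s, V v -> S s -> U (v * s).

Definition power_bounded (x : A) : Prop :=
  ring_bounded (range (fun n : nat => x ^+ n)).

Definition uniform_ring : Prop := ring_bounded [set x : A | power_bounded x].

End Boundedness.

(* Main.v *)
Require Import Defs.
From HB Require Import structures.
From mathcomp Require Import all_boot all_order all_algebra.
From mathcomp Require Import all_classical all_reals all_analysis.
From mathcomp Require Import ring lra.

Set Implicit Arguments.
Unset Strict Implicit.
Unset Printing Implicit Defensive.

Import Order.TTheory GRing.Theory Num.Theory.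
Import numFieldNormedType.Exports.

(** Why the theorem is true.

    The topology of A comes from a norm with N (x ^ 2) = (N x) ^ 2.  Let N x be
    the infimum of the |c|, c in F nonzero, such that x / c is power-bounded
    ([scalar_gauge]).  The power-bounded elements form a subring, so N is
    submultiplicative ([scalar_gauge_submul]); since |F| is dense and x is
    power-bounded as soon as x ^ 2 is, N does not drop on squares
    ([scalar_gauge_sqr]); N extends the norm of F ([scalar_gauge_scalarE]);
    and N induces the topology because the power-bounded elements form a bounded
    neighbourhood of 0 ([scalar_gauge_small], [small_scalar_gauge]).

    For a submultiplicative norm on a field, multiplicativity amounts to
    N x * N (1 / x) <= 1 for every x != 0.  Write a(y) = 1 / N (1 / y).  The
    key point ([norm_unit_descent]) is that every y != 0 admits z != 0 with
      N (z - y) <= 32 a(y)   and   a(z) <= a(y) / 2.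
    To see this, take a scalar c with 2 a(y) <= |c| <= 4 a(y).  If
    a(y - c) <= a(y) / 2, then z = y - c works.  Otherwise z = y ^ 2 / (y - c)
    does: z - y = c + c ^ 2 / (y - c) is bounded because 1 / (y - c) is, and
    1 / z = 1 / y - c / y ^ 2 is dominated by its second term, whose norm is
    |c| / a(y) ^ 2 because N is compatible with squares.

    Were N x * N (1 / x) > 1 for some x, a power y of x would satisfy
    N y > 32 a(y).  Iterating the descent from y gives a Cauchy sequence whose
    limit l satisfies N (l - y) <= 32 a(y) < N y, so that l != 0, although l is
    a limit of elements whose inverses have norms tending to infinity.  This is
    impossible in a field, since inversion is continuous at l
    ([norm_unit_small], [norm_unit_mul_le1]).

    Finally A is not discrete, as the images of the small nonzero scalars are
    nonzero and tend to 0. *)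

Local Open Scope classical_set_scope.
Local Open Scope ring_scope.

(** * Ultrametric estimates *)

Section SubmultiplicativeNorm.
Context (R : realType) (A : comPzRingType) (N : A -> R).
Hypothesis HN : submultiplicative_norm N.

Lemma submul_norm0 : N 0 = 0.
Proof. by apply/(nonarch_norm_eq0 HN). Qed.

Lemma submul_normN x : N (- x) = N x.
Proof.
have le z : N (- z) <= N z.
  have := nonarch_norm_ultra HN 0 z.
  by rewrite sub0r submul_norm0 (max_r (nonarch_norm_ge0 HN z)).
by apply/eqP; rewrite eq_le le -{1}(opprK x) le.
Qed.

Lemma submul_norm_distC x y : N (x - y) = N (y - x).
Proof. by rewrite -submul_normN opprB. Qed.

Lemma submul_normD x y : N (x + y) <= Num.max (N x) (N y).
Proof.
by have := nonarch_norm_ultra HN x (- y); rewrite opprK submul_normN.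
Qed.

Lemma submul_norm_gt0 x : x != 0 -> 0 < N x.
Proof.
move=> x0; rewrite lt_neqAle (nonarch_norm_ge0 HN) andbT eq_sym.
by apply: contra_neq x0 => /(nonarch_norm_eq0 HN).
Qed.

Lemma submul_normD_le B x y : N x <= B -> N y <= B -> N (x + y) <= B.
Proof.
by move=> xB yB; apply: le_trans (submul_normD x y) _; rewrite ge_max xB.
Qed.

Lemma submul_norm_domin x y : N (y - x) < N x -> N y = N x.
Proof.
move=> yx; apply/eqP; rewrite eq_le; apply/andP; split.
  have -> : y = (y - x) + x by rewrite subrK.
  by apply: submul_normD_le => //; exact: ltW.
rewrite leNgt; apply/negP => lt_yx.
have := submul_normD (- (y - x)) y; rewrite opprB subrK submul_norm_distC.
by rewrite le_max leNgt yx /= leNgt lt_yx.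
Qed.

Lemma submul_norm_sum B n (f : 'I_n -> A) :
  0 <= B -> (forall i, N (f i) <= B) -> N (\sum_(i < n) f i) <= B.
Proof.
move=> B0 fB; elim/big_ind: _ => //; first by rewrite submul_norm0.
by move=> x y; exact: submul_normD_le.
Qed.

Lemma submul_normMn x n : N (x *+ n) <= N x.
Proof.
elim: n => [|n IH]; first by rewrite mulr0n submul_norm0 (nonarch_norm_ge0 HN).
by rewrite mulrS; apply: submul_normD_le.
Qed.

Lemma submul_norm_steps (u : nat -> A) (n m : nat) B : (n <= m)%N -> 0 <= B ->
  (forall k, (n <= k)%N -> N (u k.+1 - u k) <= B) -> N (u m - u n) <= B.
Proof.
move=> nm B0 uB; rewrite -(subnKC nm); elim: (m - n)%N => [|k IH].
  by rewrite addn0 subrr submul_norm0.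
rewrite addnS -(subrK (u (n + k)%N) (u _.+1)) -addrA.
by apply: submul_normD_le => //; apply: uB; exact: leq_addr.
Qed.

End SubmultiplicativeNorm.

(** * Norms compatible with squares on a complete field *)

(** Sequential completeness of A for the distance N (x - y). *)
Definition norm_complete (R : realType) (A : zmodType) (N : A -> R) : Prop :=
  forall u : nat -> A,
    (forall e : R, 0 < e ->
       exists M, forall m n, (M <= m)%N -> (M <= n)%N -> N (u m - u n) < e) ->
    exists l, forall e : R, 0 < e ->
       exists M, forall n, (M <= n)%N -> N (l - u n) < e.

Section CompleteField.
Context (R : realType) (A : fieldType) (N : A -> R).
Hypothesis HN : submultiplicative_norm N.
Hypothesis Nsq : forall x, N x ^+ 2 <= N (x ^+ 2).
Hypothesis Ncomplete : norm_complete N.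
(* Scalars of roughly prescribed norm, by which multiplication scales N. *)
Hypothesis Nscale : forall r : R, 0 < r ->
  exists2 c : A, c != 0 & [/\ r <= N c, N c <= 2 * r & N c * N c^-1 <= 1].

(** With a = 1 / N y^-1, the conclusion says that z lies within 32 a of y and
    that 1 / N z^-1 is at most a / 2. *)
Lemma norm_unit_descent (y : A) : y != 0 ->
  exists z, [/\ z != 0, N (z - y) * N y^-1 <= 32 & 2 * N y^-1 <= N z^-1].
Proof.
move=> y0; have yV0 : y^-1 != 0 by rewrite invr_eq0.
have t0 := submul_norm_gt0 HN yV0; set t := N y^-1 in t0 *.
have [c c0 [lec gec NcV]] := Nscale (divr_gt0 (ltr0Sn R 1) t0).
have ct2 : 2 <= N c * t by rewrite -ler_pdivrMr.
have ct4 : N c * t <= 4.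
  by rewrite -ler_pdivlMr// (le_trans gec)// mulrA -natrM.
have Nc0 := submul_norm_gt0 HN c0.
have yc : y - c != 0.
  rewrite subr_eq0; apply: contraTneq ct2 => yc.
  by rewrite /t yc -ltNge (le_lt_trans NcV)// ltr1n.
have [far|near] := leP (2 * t) (N (y - c)^-1).
  exists (y - c); split=> //.
  by rewrite addrC addKr (submul_normN HN); apply: le_trans ct4 _; rewrite ler_nat.
(* Since N (y - c)^-1 < 2 * t, the correction c ^+ 2 / (y - c) has norm at most
   4 ^ 2 * (2 / t), which is where the constant 32 comes from. *)
exists (y ^+ 2 / (y - c)); split.
- by rewrite mulf_neq0// ?invr_eq0// expf_neq0.
- have -> : y ^+ 2 / (y - c) - y = c + c ^+ 2 * (y - c)^-1.
    by apply: (mulIf yc); rewrite mulrBl mulrDl !divfK//; ring.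
  rewrite -ler_pdivlMr//; apply: (submul_normD_le HN).
    by rewrite ler_pdivlMr//; apply: le_trans ct4 _; rewrite ler_nat.
  rewrite ler_pdivlMr//.
  have h1 : N (c ^+ 2 * (y - c)^-1) <= N c ^+ 2 * (2 * t).
    apply: le_trans (nonarch_norm_submul HN _ _) _.
    apply: ler_pM; rewrite ?(nonarch_norm_ge0 HN)//; last exact: ltW.
    by rewrite !expr2; exact: (nonarch_norm_submul HN).
  apply: le_trans (_ : N c ^+ 2 * (2 * t) * t <= _); first by rewrite ler_pM2r.
  have -> : N c ^+ 2 * (2 * t) * t = 2 * (N c * t) ^+ 2 by ring.
  have : (N c * t) ^+ 2 <= 4 ^+ 2 by rewrite ler_pXn2r// nnegrE ?mulr_ge0// ltW.
  lra.
- have -> : (y ^+ 2 / (y - c))^-1 = y^-1 - c * y^-1 ^+ 2.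
    rewrite invf_div mulrBl exprVn; congr (_ - _).
    by rewrite expr2 invfM mulrA divff// mul1r.
  (* By Nsq and N c * N c^-1 <= 1, N (c / y ^+ 2) >= N c * t ^+ 2 >= 2 * t. *)
  have big : 2 * t <= N (c * y^-1 ^+ 2).
    have h : t ^+ 2 <= N c^-1 * N (c * y^-1 ^+ 2).
      apply: le_trans (Nsq _) _.
      rewrite -{1}(mulKf c0 (y^-1 ^+ 2)); exact: (nonarch_norm_submul HN).
    have h2 : N c * t ^+ 2 <= N (c * y^-1 ^+ 2).
      apply: le_trans (_ : N c * (N c^-1 * N (c * y^-1 ^+ 2)) <= _).
        by rewrite ler_pM2l.
      by rewrite mulrA ler_piMl// (nonarch_norm_ge0 HN).
    by apply: le_trans h2; rewrite expr2 mulrA ler_pM2r.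
  suff -> : N (y^-1 - c * y^-1 ^+ 2) = N (c * y^-1 ^+ 2) by [].
  rewrite -(submul_normN HN (c * _)); apply: (submul_norm_domin HN).
  by rewrite opprK subrK (submul_normN HN) -/t (lt_le_trans _ big)// ltr_pMl// ltr1n.
Qed.

(** Iterating [norm_unit_descent] from a counterexample converges to a nonzero
    element that cannot be inverted. *)
Lemma norm_unit_small (x : A) : x != 0 -> N x * N x^-1 <= 32.
Proof.
move=> x0; rewrite leNgt; apply/negP => big.
have /choice [f fP] : forall y, exists z, y != 0 ->
    [/\ z != 0, N (z - y) * N y^-1 <= 32 & 2 * N y^-1 <= N z^-1].
  move=> y; have [->|y0] := eqVneq y 0; first by exists 0; rewrite eqxx.
  by have [z zP] := norm_unit_descent y0; exists z.
pose u n := iter n f x.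
have u0 n : u n != 0 by elim: n => //= n /fP[].
pose t n := N (u n)^-1.
have t0 n : 0 < t n by apply: (submul_norm_gt0 HN); rewrite invr_eq0.
have tS n : 2 * t n <= t n.+1 by have [] := fP _ (u0 n).
have tlin n : n%:R * t 0 <= t n.
  elim: n => [|n IH]; first by rewrite mul0r ltW.
  apply: le_trans (tS n).
  have t0n : t 0 <= t n.
    by elim: (n) => // k /le_trans; apply; have := tS k; have := t0 k; lra.
  by rewrite -natr1 mulrDl mul1r; lra.
have tmono n k : (n <= k)%N -> t n <= t k.
  move=> /subnKC <-; elim: (k - n)%N => [|j IH]; first by rewrite addn0.
  by rewrite addnS; have := tS (n + j)%N; have := t0 (n + j)%N; lra.
have step n k : (n <= k)%N -> N (u k - u n) <= 32 / t n.
  move=> nk; apply: (submul_norm_steps HN) => // [|j nj].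
    by rewrite divr_ge0// ltW.
  have [_ h _] := fP _ (u0 j).
  apply: le_trans (_ : 32 / t j <= _); first by rewrite ler_pdivlMr.
  by rewrite ler_pM2l// lef_pV2 ?posrE//; exact: tmono.
have ut e : 0 < e -> exists M, 32 / t M < e.
  move=> e0; have et0 : 0 < e * t 0 by rewrite mulr_gt0.
  exists (Num.bound (32 / (e * t 0))).
  rewrite ltr_pdivrMr//.
  apply: lt_le_trans (_ : e * (Num.bound (32 / (e * t 0)))%:R * t 0 <= _).
    rewrite mulrAC -ltr_pdivrMl// mulrC.
    by apply: archi_boundP; rewrite divr_ge0// ltW.
  by rewrite -mulrA ler_pM2l.
have [l lP] : exists l, forall e : R, 0 < e ->
       exists M, forall n, (M <= n)%N -> N (l - u n) < e.
  apply: Ncomplete => e /ut[M Me]; exists M => m n Mm Mn.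
  apply: le_lt_trans Me; have -> : u m - u n = (u m - u M) + (u M - u n) by ring.
  apply: (submul_normD_le HN); first exact: step.
  by rewrite (submul_norm_distC HN); exact: step.
have lx : N (l - x) < N x.
  have b0 : 32 / t 0 < N x by rewrite ltr_pdivrMr.
  have [M /(_ M (leqnn M)) lM] := lP _ (submul_norm_gt0 HN x0).
  have -> : l - x = (l - u M) + (u M - u 0) by rewrite addrA subrK.
  apply: le_lt_trans (submul_normD HN _ _) _.
  by rewrite gt_max lM; apply: le_lt_trans b0; exact: step.
have l0 : l != 0.
  by apply: contraTneq lx => ->; rewrite sub0r (submul_normN HN) ltxx.
have lV0 := submul_norm_gt0 HN (invr_neq0 l0).
(* Inversion is continuous at l, so the norms t n of the inverses of the terms
   of the sequence stabilize, against t n.+1 >= 2 * t n. *)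
have [M lM] : exists M, forall n, (M <= n)%N -> t n = N l^-1.
  have [M MP] := lP (N l^-1)^-1 ltac:(by rewrite invr_gt0).
  exists M => n /MP ln; apply/esym/(submul_norm_domin HN).
  have -> : l^-1 - (u n)^-1 = l^-1 * (- (l - u n)) * (u n)^-1.
    rewrite opprB mulrBr mulVf// mulrBl mul1r mulfK//.
  apply: le_lt_trans (nonarch_norm_submul HN _ _) _.
  rewrite -[X in _ < X]mul1r ltr_pM2r ?t0//.
  apply: le_lt_trans (nonarch_norm_submul HN _ _) _.
  by rewrite (submul_normN HN) mulrC -ltr_pdivlMr// div1r.
have := tS M; rewrite !lM//.
by move: lV0; lra.
Qed.

(** The bound 32 improves to 1: by [Nsq], the quantity N x * N x^-1 is at least
    squared when x is, so it cannot exceed 1 and stay bounded. *)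
Lemma norm_unit_mul_le1 (x : A) : x != 0 -> N x * N x^-1 <= 1.
Proof.
move=> x0; rewrite leNgt; apply/negP => big.
set q := N x * N x^-1 in big.
have qk k : q ^+ (2 ^ k) <= N (x ^+ (2 ^ k)) * N (x ^+ (2 ^ k))^-1.
  elim: k => [|k IH]; first by rewrite expn0 !expr1.
  rewrite expnSr !exprM.
  apply: le_trans (_ : (N (x ^+ (2 ^ k)) * N (x ^+ (2 ^ k))^-1) ^+ 2 <= _).
    rewrite ler_pXn2r// ?nnegrE ?mulr_ge0 ?exprn_ge0 ?mulr_ge0//;
      exact: (nonarch_norm_ge0 HN).
  rewrite exprMn -[in leRHS]exprVn.
  by apply: ler_pM => //; rewrite ?exprn_ge0 ?(nonarch_norm_ge0 HN).
have qn n : 1 + n%:R * (q - 1) <= q ^+ n.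
  elim: n => [|n IH]; first by rewrite mul0r addr0 expr0.
  rewrite exprS; apply: le_trans (_ : q * (1 + n%:R * (q - 1)) <= _); last first.
    by rewrite ler_pM2l//; lra.
  rewrite -natr1; have : 0 <= n%:R * (q - 1) * (q - 1) by rewrite !mulr_ge0//; lra.
  lra.
have q0 : 0 < q - 1 by rewrite subr_gt0.
set k := Num.bound (32 / (q - 1)).
have : 32 / (q - 1) < k%:R.
  by apply: archi_boundP; rewrite divr_ge0// ltW.
rewrite ltr_pdivrMr// => hk.
have k2 : (k%:R : R) <= (2 ^ k)%:R by rewrite ler_nat ltnW// ltn_expl.
have := norm_unit_small (expf_neq0 (2 ^ k) x0).
apply/negP; rewrite -ltNge; apply: lt_le_trans (qk k).
apply: lt_le_trans (qn _); rewrite ltr_wpDl//; apply: lt_le_trans hk _.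
by rewrite ler_pM2r.
Qed.

Lemma norm_multiplicative : multiplicative_norm N.
Proof.
have NM x y : N (x * y) = N x * N y.
  apply/eqP; rewrite eq_le (nonarch_norm_submul HN)/=.
  have [->|x0] := eqVneq x 0; first by rewrite !mul0r (submul_norm0 HN) mul0r.
  have := nonarch_norm_submul HN x^-1 (x * y); rewrite mulKf// => h.
  apply: le_trans (_ : N x * (N x^-1 * N (x * y)) <= _).
    by rewrite ler_wpM2l// (nonarch_norm_ge0 HN).
  by rewrite mulrA ler_piMl ?norm_unit_mul_le1// (nonarch_norm_ge0 HN).
split=> // /(nonarch_norm_eq0 HN) /eqP; exact/negP/oner_neq0.
Qed.

End CompleteField.

(** * Elements with bounded powers *)

(** Power-boundedness of x, measured by the norm N. *)
Definition norm_bounded_powers (R : realType) (A : comPzRingType)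
  (N : A -> R) (x : A) : Prop := exists B, forall n, N (x ^+ n) <= B.

Section BoundedPowers.
Context (R : realType) (A : comPzRingType) (N : A -> R).
Hypothesis HN : submultiplicative_norm N.
Local Notation pb := (norm_bounded_powers N).

Lemma norm_bounded_powersM x y : pb x -> pb y -> pb (x * y).
Proof.
move=> [B xB] [C yC]; exists (B * C) => n; rewrite exprMn.
apply: le_trans (nonarch_norm_submul HN _ _) _.
by apply: ler_pM; rewrite ?(nonarch_norm_ge0 HN).
Qed.

Lemma norm_bounded_powersB x y : pb x -> pb y -> pb (x - y).
Proof.
move=> [B xB] [C yC]; exists (B * C) => n.
have B0 : 0 <= B by apply: le_trans (xB 0); exact: nonarch_norm_ge0 HN _.
have C0 : 0 <= C by apply: le_trans (yC 0); exact: nonarch_norm_ge0 HN _.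
rewrite exprDn; apply: (submul_norm_sum HN); first exact: mulr_ge0.
move=> i; apply: le_trans (submul_normMn HN _ _) _.
apply: le_trans (nonarch_norm_submul HN _ _) _.
apply: ler_pM; rewrite ?(nonarch_norm_ge0 HN)// exprNn -signr_odd.
by case: odd; rewrite ?expr1 ?expr0 ?mulN1r ?mul1r ?(submul_normN HN).
Qed.

Lemma norm_bounded_powers_small x : N x <= 1 -> pb x.
Proof.
move=> x1; exists (Num.max 1 (N 1)); case=> [|n]; first by rewrite le_max lexx orbT.
rewrite le_max; apply/orP; left; elim: n => [|n IH]; first by rewrite expr1.
rewrite exprS; apply: le_trans (nonarch_norm_submul HN _ _) _.
by rewrite mulr_ile1 ?(nonarch_norm_ge0 HN).
Qed.

Lemma norm_bounded_powers_sqrt x : pb (x ^+ 2) -> pb x.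
Proof.
move=> [B xB]; exists (Num.max (N 1) (N x) * B) => n.
rewrite -(odd_double_half n) -muln2 mulnC exprD exprM.
apply: le_trans (nonarch_norm_submul HN _ _) _.
apply: ler_pM; rewrite ?(nonarch_norm_ge0 HN)//.
by case: odd; rewrite /= ?expr1 ?expr0 le_max lexx ?orbT.
Qed.

End BoundedPowers.

(** * The gauge of the power-bounded elements *)

(** The gauge of the set of power-bounded elements with respect to the scalars
    of F: the infimum of the normF c, c != 0, such that x / c has bounded
    powers for N. *)
Definition scalar_gauge (R : realType) (F : fieldType) (A : comPzRingType)
  (normF : F -> R) (phi : F -> A) (N : A -> R) (x : A) : R :=
  inf [set normF c | c in
    [set c | c != 0 /\ norm_bounded_powers N (phi c^-1 * x)]].

Section ScalarGauge.
Context (R : realType) (F : fieldType) (A : comPzRingType).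
Context (normF : F -> R) (phi : {rmorphism F -> A}) (N : A -> R).
Hypothesis HF : multiplicative_norm normF.
Hypothesis normF_dense : forall s r, 0 <= s -> s < r ->
  exists2 c, c != 0 & s < normF c < r.
Hypothesis HN : submultiplicative_norm N.
Hypothesis phi_small : forall e, 0 < e ->
  exists2 d, 0 < d & forall a, normF a < d -> N (phi a) < e.
Hypothesis N_uniform : exists B, forall x, norm_bounded_powers N x -> N x <= B.
Local Notation pb := (norm_bounded_powers N).
Local Notation gauge := (scalar_gauge normF phi N).

Let HFs := multiplicative_norm_submul HF.

Lemma multiplicative_norm1 : normF 1 = 1.
Proof.
have := multiplicative_normM HF 1 1; rewrite mulr1 => h.
apply: (mulfI (introN eqP (multiplicative_norm1_neq0 HF))).
by rewrite mulr1 -h.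
Qed.

Lemma multiplicative_normV c : normF c^-1 = (normF c)^-1.
Proof.
have [->|c0] := eqVneq c 0; first by rewrite invr0 (submul_norm0 HFs) invr0.
have nc0 := lt0r_neq0 (submul_norm_gt0 HFs c0).
by apply: (mulfI nc0); rewrite -(multiplicative_normM HF) !mulfV// multiplicative_norm1.
Qed.

Lemma norm_bounded_powers_scalar c : normF c <= 1 -> pb (phi c).
Proof.
move=> c1; have [d d0 dP] := phi_small ltr01.
have [a a0 /andP[_ ad]] := normF_dense (lexx 0) d0.
exists (N (phi a^-1) * 1) => n.
have -> : phi c ^+ n = phi a^-1 * phi (a * c ^+ n).
  by rewrite -rmorphXn -rmorphM mulKf.
apply: le_trans (nonarch_norm_submul HN _ _) _.
rewrite ler_wpM2l ?(nonarch_norm_ge0 HN)// ltW// dP//.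
rewrite (multiplicative_normM HF); apply: le_lt_trans ad.
rewrite ler_piMr ?(nonarch_norm_ge0 HFs)//.
elim: n => [|n IH]; first by rewrite expr0 multiplicative_norm1.
by rewrite exprS (multiplicative_normM HF) mulr_ile1 ?(nonarch_norm_ge0 HFs).
Qed.

Let gauge_set x := [set normF c | c in [set c | c != 0 /\ pb (phi c^-1 * x)]].

Lemma gauge_set_lbound x : lbound (gauge_set x) 0.
Proof. by move=> _ [c _ <-]; exact: nonarch_norm_ge0 HFs _. Qed.

Lemma gauge_set_nonempty x : gauge_set x !=set0.
Proof.
have [d d0 dP] : exists2 d, 0 < d & forall a, normF a < d -> N (phi a) < (N x + 1)^-1.
  by apply: phi_small; rewrite invr_gt0 ltr_wpDl// (nonarch_norm_ge0 HN).
have [a a0 /andP[_ ad]] := normF_dense (lexx 0) d0.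
exists (normF a^-1), a^-1 => //=; split; first by rewrite invr_eq0.
rewrite invrK; apply: (norm_bounded_powers_small HN).
apply: le_trans (nonarch_norm_submul HN _ _) _.
have x1 : 0 < N x + 1 by rewrite ltr_wpDl// (nonarch_norm_ge0 HN).
have := ltW (dP _ ad); rewrite -[_^-1]div1r ler_pdivlMr// => /(le_trans _); apply.
by rewrite ler_wpM2l ?(nonarch_norm_ge0 HN)// lerDl.
Qed.

Lemma scalar_gauge_ge0 x : 0 <= gauge x.
Proof. by apply: lb_le_inf; [exact: gauge_set_nonempty|exact: gauge_set_lbound]. Qed.

Lemma scalar_gauge_le x c : c != 0 -> pb (phi c^-1 * x) -> gauge x <= normF c.
Proof.
move=> c0 cx; apply: ge_inf; first by exists 0; exact: gauge_set_lbound.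
by exists c.
Qed.

Lemma scalar_gauge_lt x r : gauge x < r ->
  exists c, [/\ c != 0, normF c < r & pb (phi c^-1 * x)].
Proof.
by move=> /(inf_lt (gauge_set_nonempty x))[_ [c [c0 cx] <-] cr]; exists c.
Qed.

(** Every scalar d of norm greater than gauge x works: x / d = (c / d) * (x / c)
    for some c with normF c < normF d and x / c power-bounded. *)
Lemma scalar_gauge_pb x d : gauge x < normF d -> pb (phi d^-1 * x).
Proof.
move=> /scalar_gauge_lt[c [c0 cd cx]].
have -> : phi d^-1 * x = phi (c / d) * (phi c^-1 * x).
  by rewrite mulrA -rmorphM mulrAC divff// mul1r.
apply: (norm_bounded_powersM HN) => //; apply: norm_bounded_powers_scalar.
have d0 : 0 < normF d by apply: le_lt_trans cd; exact: nonarch_norm_ge0 HFs _.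
by rewrite (multiplicative_normM HF) multiplicative_normV ler_pdivrMr// mul1r ltW.
Qed.

(** Density of the norm group lets the gauge be bounded by testing scalars of
    norm greater than r only. *)
Lemma scalar_gauge_le_dense x r : 0 <= r ->
  (forall c, c != 0 -> r < normF c -> pb (phi c^-1 * x)) -> gauge x <= r.
Proof.
move=> r0 rP; rewrite leNgt; apply/negP => /(normF_dense r0)[c c0 /andP[rc]].
by apply/negP; rewrite -leNgt; apply: scalar_gauge_le => //; exact: rP.
Qed.

Lemma scalar_gauge_scalar c : gauge (phi c) <= normF c.
Proof.
apply: scalar_gauge_le_dense; first exact: nonarch_norm_ge0 HFs _.
move=> d d0 cd; rewrite -rmorphM; apply: norm_bounded_powers_scalar.
rewrite (multiplicative_normM HF) multiplicative_normV mulrC.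
by rewrite ler_pdivrMr ?(submul_norm_gt0 HFs)// mul1r ltW.
Qed.

(** The topology of the gauge is finer than that of N: this is where uniformity,
    in the form of [N_uniform], is needed. *)
Lemma scalar_gauge_small e : 0 < e ->
  exists2 d, 0 < d & forall x, gauge x < d -> N x < e.
Proof.
move=> e0; have [B BP] := N_uniform.
have B1 : 0 < `|B| + 1 by rewrite ltr_wpDl.
have [d d0 dP] := phi_small (divr_gt0 e0 B1).
exists d => // x /scalar_gauge_lt[c [c0 cd cx]].
have -> : x = phi c * (phi c^-1 * x).
  by rewrite mulrA -rmorphM divff// rmorph1 mul1r.
apply: le_lt_trans (nonarch_norm_submul HN _ _) _.
have := dP _ cd; rewrite ltr_pdivlMr//; apply: le_lt_trans.
rewrite ler_wpM2l ?(nonarch_norm_ge0 HN)//.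
by apply: le_trans (BP _ cx) _; rewrite (le_trans (ler_norm B))// lerDl.
Qed.

Lemma small_scalar_gauge e : 0 < e ->
  exists2 d, 0 < d & forall x, N x < d -> gauge x < e.
Proof.
move=> e0; have [c c0 /andP[_ ce]] := normF_dense (lexx 0) e0.
have C0 : 0 < N (phi c^-1) + 1 by rewrite ltr_wpDl// (nonarch_norm_ge0 HN).
exists (N (phi c^-1) + 1)^-1; first by rewrite invr_gt0.
move=> x xd; apply: le_lt_trans ce; apply: scalar_gauge_le => //.
apply: (norm_bounded_powers_small HN).
apply: le_trans (nonarch_norm_submul HN _ _) _.
move: xd; rewrite -[_^-1]div1r ltr_pdivlMr// mulrC => /ltW; apply: le_trans.
by rewrite ler_wpM2r ?(nonarch_norm_ge0 HN)// lerDl.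
Qed.

Lemma scalar_gauge_submul : submultiplicative_norm gauge.
Proof.
split=> [x|x|x y|x y]; first exact: scalar_gauge_ge0.
- split=> [x0|->].
    apply: contrapT => /eqP /(submul_norm_gt0 HN) /scalar_gauge_small[d d0].
    by move=> /(_ x); rewrite x0 ltxx => /(_ d0).
  apply/eqP; rewrite eq_le scalar_gauge_ge0 andbT -(rmorph0 phi).
  by rewrite (le_trans (scalar_gauge_scalar _))// (submul_norm0 HFs).
- apply: scalar_gauge_le_dense; first by rewrite le_max scalar_gauge_ge0.
  move=> c c0; rewrite gt_max => /andP[xc yc].
  by rewrite mulrBr; apply: (norm_bounded_powersB HN); exact: scalar_gauge_pb.
- apply: scalar_gauge_le_dense; first by rewrite mulr_ge0 ?scalar_gauge_ge0.
  move=> c c0 xyc; have nc0 := submul_norm_gt0 HFs c0.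
  have [d d0 [xd yd]] : exists2 d, d != 0 & gauge x < normF d /\ gauge y < normF (c / d).
    have cd d : d != 0 -> normF (c / d) = normF c / normF d.
      by rewrite (multiplicative_normM HF) multiplicative_normV.
    (* The scalar c has to be split as d * (c / d), with normF d between gauge x
       and normF c / gauge y (any large normF d will do if gauge y = 0). *)
    have [y0|y0] := eqVneq (gauge y) 0.
      have [d d0 /andP[xd _]] : exists2 d, d != 0 & gauge x < normF d < gauge x + 1.
        by apply: normF_dense; rewrite ?scalar_gauge_ge0// ltrDl.
      by exists d => //; split=> //; rewrite y0 cd// divr_gt0// (submul_norm_gt0 HFs).
    have yp : 0 < gauge y by rewrite lt_neqAle eq_sym y0 scalar_gauge_ge0.
    have [d d0 /andP[xd dc]] : exists2 d, d != 0 & gauge x < normF d < normF c / gauge y.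
      by apply: normF_dense; rewrite ?scalar_gauge_ge0// ltr_pdivlMr.
    exists d => //; split=> //; rewrite cd// ltr_pdivlMr ?(submul_norm_gt0 HFs)//.
    by rewrite mulrC -ltr_pdivlMr.
  have -> : phi c^-1 * (x * y) = (phi d^-1 * x) * (phi (c / d)^-1 * y).
    rewrite mulrACA -rmorphM; congr (phi _ * _).
    by rewrite invf_div mulrA mulVf// mul1r.
  by apply: (norm_bounded_powersM HN); exact: scalar_gauge_pb.
Qed.

(** Otherwise a scalar d has norm strictly between the square root of
    gauge (x ^+ 2) and gauge x; then (x / d) ^+ 2 is power-bounded, hence so is
    x / d, which bounds gauge x by normF d. *)
Lemma scalar_gauge_sqr x : gauge x ^+ 2 <= gauge (x ^+ 2).
Proof.
rewrite leNgt; apply/negP => lt.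
have s0 := scalar_gauge_ge0 (x ^+ 2); have x0 := scalar_gauge_ge0 x.
have : Num.sqrt (gauge (x ^+ 2)) < gauge x.
  by rewrite -(ltr_pXn2r (ltn0Sn 1)) ?nnegrE ?sqrtr_ge0// sqr_sqrtr.
move=> /(normF_dense (sqrtr_ge0 _))[d d0 /andP[sd]].
apply/negP; rewrite -leNgt; apply: scalar_gauge_le => //.
apply: (norm_bounded_powers_sqrt HN); rewrite exprMn -rmorphXn exprVn.
apply: scalar_gauge_pb; rewrite expr2 (multiplicative_normM HF) -expr2.
by rewrite -(sqr_sqrtr s0) ltr_pXn2r// nnegrE ?sqrtr_ge0 ?(nonarch_norm_ge0 HFs).
Qed.

Lemma scalar_gauge_scalarE c : (1 : A) != 0 -> c != 0 -> gauge (phi c) = normF c.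
Proof.
move=> A1 c0; apply/eqP; rewrite eq_le scalar_gauge_scalar/=.
have g1 : 1 <= gauge 1.
  have g0 := submul_norm_gt0 scalar_gauge_submul A1.
  have := nonarch_norm_submul scalar_gauge_submul 1 1.
  by rewrite mulr1 -{1}[gauge 1]mulr1 ler_pM2l.
have := nonarch_norm_submul scalar_gauge_submul (phi c) (phi c^-1).
rewrite -rmorphM mulfV// rmorph1 => /(le_trans g1) h.
have nc0 := submul_norm_gt0 HFs c0.
rewrite -[leLHS]mul1r -ler_pdivlMr//; apply: le_trans h _.
by rewrite -multiplicative_normV ler_wpM2l ?scalar_gauge_ge0// scalar_gauge_scalar.
Qed.

End ScalarGauge.

(** * Topologies induced by norms *)

Section InducedTopology.
Context (R : realType).

Lemma induces_topologyP (A : topologicalComRingType) (N : A -> R) :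
  induces_topology N -> forall x U,
  nbhs x U <-> exists2 e, 0 < e & forall y, N (x - y) < e -> U y.
Proof. by move=> topN x U; rewrite topN; split. Qed.

Lemma induces_topology0P (A : topologicalComRingType) (N : A -> R) :
  submultiplicative_norm N -> induces_topology N -> forall U,
  nbhs (0 : A) U <-> exists2 e, 0 < e & forall y, N y < e -> U y.
Proof.
move=> HN /induces_topologyP topN U; split=> [/topN|] [e e0 eU].
  by exists e => // y ye; apply: eU; rewrite sub0r (submul_normN HN).
by apply/topN; exists e => // y; rewrite sub0r (submul_normN HN); exact: eU.
Qed.

Lemma induces_topology_equiv (A : topologicalComRingType) (N M : A -> R) :
  induces_topology N ->
  (forall e, 0 < e -> exists2 d, 0 < d & forall x, N x < d -> M x < e) ->
  (forall e, 0 < e -> exists2 d, 0 < d & forall x, M x < d -> N x < e) ->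
  induces_topology M.
Proof.
move=> topN NM MN x; apply/seteqP; split=> U.
  move=> /(induces_topologyP topN)[e e0 eU]; have [d d0 dP] := MN _ e0.
  by exists d => // y /dP /eU.
move=> [e e0 eU]; apply/(induces_topologyP topN).
have [d d0 dP] := NM _ e0.
by exists d => // y /dP; exact: eU.
Qed.

Lemma banach_norm_complete (A : banachRingType R) (N : A -> R) :
  submultiplicative_norm N -> induces_topology N -> norm_complete N.
Proof.
move=> HN topN u uC.
have [l ul] : exists l : A, u @ \oo --> l.
  apply: (@banach_complete R A (u @ \oo)).
  move=> U /(induces_topology0P HN topN)[e e0 eU].
  have [M MP] := uC _ e0.
  exists (u @` [set n | (M <= n)%N], u @` [set n | (M <= n)%N]) => /=.
    by split; exists M => // n /= Mn; exists n.
  by move=> [a b] /= [[m Mm <-] [n Mn <-]]; exact/eU/MP.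
exists l => e e0; have [|M _ MP] := ul [set y | N (l - y) < e].
  by apply/(induces_topologyP topN); exists e.
by exists M => n Mn; exact: MP.
Qed.

(** In a field with arbitrarily small nonzero elements, boundedness in the
    topological sense is boundedness for the norm. *)
Lemma ring_boundedP (A : banachFieldType R) (N : A -> R) :
  submultiplicative_norm N -> induces_topology N ->
  (forall e, 0 < e -> exists2 v : A, v != 0 & N v < e) ->
  forall S, ring_bounded S <-> exists B, forall s, S s -> N s <= B.
Proof.
move=> HN topN small S; split=> [|[B BP] U].
  have U0 : nbhs (0 : A) [set y | N y < 1].
    by apply/(induces_topology0P HN topN); exists 1.
  move=> /(_ _ U0)[V /(induces_topology0P HN topN)[e e0 eV] VS].
  have [v v0 ve] := small _ e0.
  exists (N v^-1 * 1) => s Ss; rewrite -(mulKf v0 s).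
  apply: le_trans (nonarch_norm_submul HN _ _) _.
  rewrite ler_wpM2l ?(nonarch_norm_ge0 HN)// ltW//.
  by apply: VS => //; exact: eV.
move=> /(induces_topology0P HN topN)[e e0 eU].
have B1 : 0 < `|B| + 1 by rewrite ltr_wpDl.
exists [set v | N v < e / (`|B| + 1)].
  by apply/(induces_topology0P HN topN); exists (e / (`|B| + 1)); rewrite ?divr_gt0.
move=> v s /= ve Ss; apply: eU.
apply: le_lt_trans (nonarch_norm_submul HN _ _) _.
move: ve; rewrite ltr_pdivlMr//; apply: le_lt_trans.
rewrite ler_wpM2l ?(nonarch_norm_ge0 HN)//.
by apply: le_trans (BP _ Ss) _; rewrite (le_trans (ler_norm B))// lerDl.
Qed.

Lemma norm_group_dense (F : banachFieldType R) (normF : F -> R) :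
  [set r : R | 0 < r] `<=` closure (norm_group normF) ->
  forall s r, 0 <= s -> s < r -> exists2 c, c != 0 & s < normF c < r.
Proof.
move=> dense s r s0 sr.
have m0 : 0 < (s + r) / 2 by lra.
have mB : nbhs ((s + r) / 2) [set` `]s, r[].
  by apply: near_in_itvoo; rewrite in_itv/=; lra.
have [_ [[c c0 <-]]] := dense _ m0 _ mB.
by rewrite /= in_itv/= => cr; exists c.
Qed.

End InducedTopology.

(** * Uniform Banach fields over a field with dense norm group *)

Theorem theorem3p7 (R : realType)
    (F : banachFieldType R) (HF : nonarchimedean_field F)
    (normF : F -> R) (normF_mul : multiplicative_norm normF)
    (normF_top : induces_topology normF)
    (normF_dense : [set r : R | 0 < r] `<=` closure (norm_group normF))
    (A : banachFieldType R)
    (phi : {rmorphism F -> A}) (phi_cont : continuous phi)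
    (A_uniform : uniform_ring A) :
  nonarchimedean_field A.
Proof.
have HFs := multiplicative_norm_submul normF_mul.
have dense := norm_group_dense normF_dense.
have [N [HN topN]] := @banach_norm_exists R A.
have phi_small e : 0 < e ->
    exists2 d, 0 < d & forall a, normF a < d -> N (phi a) < e.
  move=> e0; apply/(induces_topology0P HFs normF_top [set a | N (phi a) < e]).
  apply: (phi_cont 0 [set y | N y < e]); rewrite rmorph0.
  by apply/(induces_topology0P HN topN); exists e.
have A_small e : 0 < e -> exists2 v : A, v != 0 & N v < e.
  move=> /phi_small[d d0 dP]; have [c c0 /andP[_ cd]] := dense _ _ (lexx 0) d0.
  by exists (phi c); [rewrite fmorph_eq0|exact: dP].
have bP := ring_boundedP HN topN A_small.
have N_uniform : exists B, forall x, norm_bounded_powers N x -> N x <= B.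
  have [B BP] := (bP _).1 A_uniform.
  exists B => x [C xC]; apply: BP; apply/bP; exists C => _ [n _ <-]; exact: xC.
pose g := scalar_gauge normF phi N.
have Hg : submultiplicative_norm g by exact: scalar_gauge_submul.
have topg : induces_topology g.
  apply: (induces_topology_equiv topN); first exact: small_scalar_gauge.
  exact: scalar_gauge_small.
split.
  move=> disc.
  have : nbhs (0 : A) [set 0] by apply: open_nbhs_nbhs; split=> //; exact: disc.
  move=> /(induces_topology0P HN topN)[e /A_small[v v0 ve] /(_ _ ve) /eqP].
  exact/negP.
exists g; split=> //; apply: norm_multiplicative => //.
- exact: scalar_gauge_sqr.
- exact: banach_norm_complete.
- move=> r r0; have [|c c0 /andP[rc cr]] := dense r (2 * r) (ltW r0).
    lra.
  exists (phi c); first by rewrite fmorph_eq0.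
  rewrite -fmorphV /g !scalar_gauge_scalarE ?oner_neq0 ?invr_eq0//.
  split; [exact: ltW|exact: ltW|].
  by rewrite -(multiplicative_normM normF_mul) mulfV// multiplicative_norm1.
Qed.
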